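(* Let $R$ be a commutative ring with unity, $t$ a positive integer and $a\in R$. Then $$a^{t}\Gamma_{a}(R)[x]=a^{t}\Gamma_{a}(R[x]).$$
   Context: For an $R$-module $M$, $\Gamma_{a}(M):=\{m\in M\mid a^{k}m=0\text{ for some }k\in\mathbb{Z}^{+}\}$ and $a^{t}\Gamma_{a}(M):=\{a^{t}m\mid m\in\Gamma_{a}(M)\}$. $R[x]$ is the polynomial ring over $R$ in one variable; $a^{t}\Gamma_{a}(R)[x]$ denotes the set of polynomials in $R[x]$ all of whose coefficients lie in the ideal $a^{t}\Gamma_{a}(R)$ of $R$. *)

(* Defs.v *)
From HB Require Import structures.
From mathcomp Require Import all_boot all_order all_algebra.
From mathcomp Require Import classical_sets.

Set Implicit Arguments.
Unset Strict Implicit.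
Unset Printing Implicit Defensive.

Import GRing.Theory.
Local Open Scope classical_set_scope.
Local Open Scope ring_scope.

Definition Gamma (R : comNzRingType) (M : lmodType R) (a : R) : set M :=
  [set m | exists2 k : nat, (0 < k)%N & a ^+ k *: m = 0].

Definition powGamma (R : comNzRingType) (M : lmodType R) (a : R) (t : nat) :
    set M :=
  [set a ^+ t *: m | m in @Gamma R M a].

Definition poly_in (R : comNzRingType) (I : set R) : set {poly R} :=
  [set p | forall i : nat, I p`_i].

Arguments Gamma {R} M a.
Arguments powGamma {R} M a t.

(* Main.v *)
Require Import Defs.
From HB Require Import structures.
From mathcomp Require Import all_boot all_order all_algebra.
From mathcomp Require Import classical_sets.

(** Every linear map commutes with multiplication by [a], and hence preserves
    being killed by a power of [a], so [a^t Gamma_a] is functorial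
    ([powGamma_scalable]).  Applied to the coefficient maps from [R[x]] to [R],
    this shows that the coefficients of an element of [a^t Gamma_a(R[x])] lie
    in [a^t Gamma_a(R)].  Applied to the maps [c |-> c x^i] from [R] to [R[x]],
    it puts in [a^t Gamma_a(R[x])] each monomial of a polynomial whose
    coefficients lie in [a^t Gamma_a(R)]; the polynomial itself follows because
    it is the finite sum of its monomials and [a^t Gamma_a] is closed under
    addition ([powGamma_add]).  Finiteness of the sum matters: a common power
    of [a] kills the finitely many summands. *)

Set Implicit Arguments.
Unset Strict Implicit.
Unset Printing Implicit Defensive.

Import GRing.Theory.
Local Open Scope classical_set_scope.
Local Open Scope ring_scope.

Lemma powGamma0 (R : comNzRingType) (M : lmodType R) (a : R) (t : nat) :
  powGamma M a t 0.
Proof. by exists 0; [exists 1%N; rewrite ?scaler0 | rewrite scaler0]. Qed.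

(** If [a^k] kills [m] and [a^l] kills [n], then [a^(k + l)] kills both. *)
Lemma Gamma_add (R : comNzRingType) (M : lmodType R) (a : R) (m n : M) :
  Gamma M a m -> Gamma M a n -> Gamma M a (m + n).
Proof.
move=> [k k_gt0 akm] [l _ aln]; exists (k + l)%N; first by rewrite addn_gt0 k_gt0.
by rewrite scalerDr [in X in X + _]addnC !exprD -!scalerA akm aln !scaler0 addr0.
Qed.

Lemma powGamma_add (R : comNzRingType) (M : lmodType R) (a : R) (t : nat)
    (u v : M) :
  powGamma M a t u -> powGamma M a t v -> powGamma M a t (u + v).
Proof.
move=> [m Gm <-] [n Gn <-]; exists (m + n); last by rewrite scalerDr.
exact: Gamma_add.
Qed.

(** A map commuting with scalars sends [0 = 0 *: 0] to [0], so it carries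
    [a]-torsion to [a]-torsion. *)
Lemma powGamma_scalable (R : comNzRingType) (M N : lmodType R) (f : M -> N)
    (a : R) (t : nat) (u : M) :
  scalable f -> powGamma M a t u -> powGamma N a t (f u).
Proof.
move=> fZ [m [k k_gt0 akm] <-]; exists (f m); last by rewrite fZ.
by exists k; rewrite // -fZ akm -(scale0r 0) fZ scale0r.
Qed.

Theorem proposition4p5 (R : comNzRingType) (t : nat) (a : R) (ht : (0 < t)%N) :
  @poly_in R (powGamma R^o a t) = powGamma {poly R} a t.
Proof.
apply/seteqP; split=> p Gp.
  rewrite -[p]coefK poly_def.
  apply: big_ind; [exact: powGamma0 | exact: powGamma_add | move=> i _].
  apply: (@powGamma_scalable R R^o {poly R} (fun c => c *: 'X^i)) (Gp i).
  by move=> b c; rewrite scalerA.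
move=> i; apply: (@powGamma_scalable R {poly R} R^o (fun q => q`_i)) Gp.
by move=> b q; rewrite coefZ.
Qed.
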